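(* Let $n\ge 1$ and let $\Phi=(\Phi_1,\dots,\Phi_n)$ be the map $$\Phi_i(\mathbf{E}) = A_i^e\,\mathbb{V}_i^e(\mathbf{E}) - L_i^e + \sum_{j=1}^n A_{ij}\,\mathbb{V}_{ij}(\mathbf{E}) - \sum_{j=1}^n L_{ij},\qquad i=1,\dots,n.$$ Assume that all valuation functions $\mathbb{V}_i^e,\mathbb{V}_{ij}$ are feasible (take values in $[0,1]$, are non-decreasing, and are continuous from above). Define a sequence by $\mathbf{E}^{(0)}=\mathbf{M}$, where $M_i=A_i^e-L_i^e+\sum_{j}A_{ij}-\sum_j L_{ij}$, and $\mathbf{E}^{(k+1)}=\Phi(\mathbf{E}^{(k)})$ for $k\ge 0$. Then: 1. the sequence $\{\mathbf{E}^{(k)}\}$ is monotonic non-increasing: $\mathbf{E}^{(k+1)}\le\mathbf{E}^{(k)}$ for all $k\ge 0$; 2. the sequence $\{\mathbf{E}^{(k)}\}$ converges to a limit $\mathbf{E}^\infty=\lim_{k\to\infty}\mathbf{E}^{(k)}$; 3. $\mathbf{E}^\infty$ is a solution of $\mathbf{E}=\Phi(\mathbf{E})$, and furthermore $\mathbf{E}^\infty=\mathbf{E}^{\mathrm{max}}$, the greatest solution of this equation (i.e. every solution $\mathbf{E}^*$ satisfies $\mathbf{E}^*\le\mathbf{E}^{\infty}$).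
   Context: A financial system of $n$ banks is considered at a fixed time. For each bank $i$, the real numbers $A_i^e\ge 0$ and $L_i^e\ge 0$ are the book values of its external assets and external liabilities. For $i,j\in\{1,\dots,n\}$, $L_{ij}\ge 0$ is the book value of the liability of bank $i$ towards bank $j$, and $A_{ij}\ge 0$ is the book value of the interbank asset of bank $i$ towards bank $j$, with $A_{ji}=L_{ij}$. The external valuation functions $\mathbb{V}_i^e$ and interbank valuation functions $\mathbb{V}_{ij}$ are functions of the equity vector $\mathbf{E}=(E_1,\dots,E_n)\in\mathbb{R}^n$ (possibly depending on only some of its components). Vector inequalities are componentwise. A valuation function $\mathbb{V}$ is feasible if: it takes values in $[0,1]$; it is non-decreasing ($\mathbf{E}\le\mathbf{E}'$ implies $\mathbb{V}(\mathbf{E})\le\mathbb{V}(\mathbf{E}')$); and it is continuous from above, meaning that $\mathbb{V}(\mathbf{E}^{(k)})\to\mathbb{V}(\mathbf{E})$ whenever $\mathbf{E}^{(k)}$ is a (componentwise) non-increasing sequence converging to $\mathbf{E}$. *)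

(* Defs.v *)
From HB Require Import structures.
From mathcomp Require Import all_boot all_order all_algebra.
From mathcomp Require Import all_classical all_reals all_analysis.

Set Implicit Arguments.
Unset Strict Implicit.
Unset Printing Implicit Defensive.

Import Order.TTheory GRing.Theory Num.Theory.
Import numFieldTopology.Exports.
Import numFieldNormedType.Exports.

Local Open Scope classical_set_scope.
Local Open Scope ring_scope.

Definition lev (R : realType) (n : nat) (x y : 'rV[R]_n) : Prop :=
  forall i : 'I_n, x ord0 i <= y ord0 i.

Definition continuous_from_above (R : realType) (n : nat)
    (V : 'rV[R]_n -> R) : Prop :=
  forall (u : nat -> 'rV[R]_n) (E : 'rV[R]_n),
    (forall k : nat, lev (u k.+1) (u k)) ->
    u @ \oo --> E ->
    (fun k : nat => V (u k)) @ \oo --> V E.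

Definition feasible (R : realType) (n : nat) (V : 'rV[R]_n -> R) : Prop :=
  [/\ forall E : 'rV[R]_n, 0 <= V E <= 1,
      forall E E' : 'rV[R]_n, lev E E' -> V E <= V E'
    & continuous_from_above V].

Definition Phi (R : realType) (n : nat) (Ae Le : 'rV[R]_n) (A L : 'M[R]_n)
    (Ve : 'I_n -> 'rV[R]_n -> R) (V : 'I_n -> 'I_n -> 'rV[R]_n -> R)
    (E : 'rV[R]_n) : 'rV[R]_n :=
  \row_(i < n) (Ae ord0 i * Ve i E - Le ord0 i
                + \sum_(j < n) A i j * V i j E - \sum_(j < n) L i j).

Definition book_equity (R : realType) (n : nat) (Ae Le : 'rV[R]_n)
    (A L : 'M[R]_n) : 'rV[R]_n :=
  \row_(i < n) (Ae ord0 i - Le ord0 i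
                + \sum_(j < n) A i j - \sum_(j < n) L i j).

Definition solution (R : realType) (n : nat) (F : 'rV[R]_n -> 'rV[R]_n)
    (E : 'rV[R]_n) : Prop := E = F E.

Definition greatest_solution (R : realType) (n : nat)
    (F : 'rV[R]_n -> 'rV[R]_n) (E : 'rV[R]_n) : Prop :=
  solution F E /\ forall E' : 'rV[R]_n, solution F E' -> lev E' E.

(* Main.v *)
(** [Phi] is monotone, and its values lie between the book equity and the vector
    with entries [- Le_i - \sum_j L_ij].  Hence the iterates started at the book
    equity decrease and are bounded below, so they converge componentwise;
    continuity from above makes the limit a fixed point.  Any fixed point lies
    below the book equity, hence by monotonicity below every iterate, hence
    below the limit. *)

Require Import Defs.
From HB Require Import structures.
From mathcomp Require Import all_boot all_order all_algebra.
From mathcomp Require Import all_classical all_reals all_analysis.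

Set Implicit Arguments.
Unset Strict Implicit.
Unset Printing Implicit Defensive.

Import Order.TTheory GRing.Theory Num.Theory.
Import numFieldTopology.Exports.
Import numFieldNormedType.Exports.

Local Open Scope classical_set_scope.
Local Open Scope ring_scope.

(** Forward, coordinate projections are continuous. Backward, matrix entourages are tested
    entrywise, and the finitely many eventual conditions, one per column, hold simultaneously from
    some rank on. *)
Lemma cvg_row (R : realType) (n : nat) (u : nat -> 'rV[R]_n) (l : 'rV[R]_n) :
  u @ \oo --> l <-> forall i, (fun k => u k ord0 i) @ \oo --> l ord0 i.
Proof.
split=> [ul i|ul]; last first.
  apply/cvg_mx_entourageP => A entA.
  have : \forall k \near \oo, forall j, A (l ord0 j, u k ord0 j).
    by apply: filter_forall => j; have /cvg_app_entourageP := ul j; apply.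
  by apply: filterS => k Ak i j; rewrite ord1; apply/mem_set.
have coord := @coord_continuous R 1 n ord0 i l.
exact: (@continuous_cvg _ _ _ _ _ u (fun M => M ord0 i) l coord ul).
Qed.

Section Valuation.
Variables (R : realType) (n : nat) (Ae Le : 'rV[R]_n) (A L : 'M[R]_n).
Variables (Ve : 'I_n -> 'rV[R]_n -> R) (V : 'I_n -> 'I_n -> 'rV[R]_n -> R).
Hypothesis Ae_ge0 : forall i, 0 <= Ae ord0 i.
Hypothesis A_ge0 : forall i j, 0 <= A i j.
Hypothesis Ve_feasible : forall i, feasible (Ve i).
Hypothesis V_feasible : forall i j, feasible (V i j).

Local Notation F := (Phi Ae Le A L Ve V).

Lemma Phi_homo (x y : 'rV[R]_n) : lev x y -> lev (F x) (F y).
Proof.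
move=> xy i; rewrite !mxE lerD2r; apply: lerD.
  by rewrite lerD2r ler_wpM2l//; have [_ + _] := Ve_feasible i; apply.
by apply: ler_sum => j _; rewrite ler_wpM2l//;
  have [_ + _] := V_feasible i j; apply.
Qed.

(** Setting every valuation to its upper bound 1 in [Phi] gives the book equity. *)
Lemma Phi_le_book_equity (x : 'rV[R]_n) : lev (F x) (book_equity Ae Le A L).
Proof.
move=> i; rewrite !mxE lerD2r; apply: lerD.
  by rewrite lerD2r ler_piMr//; have [/(_ x)/andP[]] := Ve_feasible i.
by apply: ler_sum => j _; rewrite ler_piMr//;
  have [/(_ x)/andP[]] := V_feasible i j.
Qed.

(** Here every valuation is replaced by 0; the bound does not depend on [x], so it is uniform along
    the iterates. *)
Lemma Phi_ge (x : 'rV[R]_n) (i : 'I_n) :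
  - Le ord0 i - \sum_(j < n) L i j <= F x ord0 i.
Proof.
rewrite mxE lerD2r -[leLHS]addr0; apply: lerD.
  by rewrite lerDr mulr_ge0//; have [/(_ x)/andP[]] := Ve_feasible i.
by apply: sumr_ge0 => j _; rewrite mulr_ge0//;
  have [/(_ x)/andP[]] := V_feasible i j.
Qed.

(** Each entry of [F] is a finite combination of valuations with constant coefficients. Monotonicity
    of [u] is what gives access to continuity from above. *)
Lemma Phi_cvg (u : nat -> 'rV[R]_n) (l : 'rV[R]_n) :
  (forall k, lev (u k.+1) (u k)) -> u @ \oo --> l -> F (u k) @[k --> \oo] --> F l.
Proof.
move=> u_noninc ul; apply/cvg_row => i; rewrite mxE.
under eq_fun do rewrite mxE.
apply: cvgB; last exact: cvg_cst.
apply: cvgD; first (apply: cvgB; last exact: cvg_cst).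
  by apply: cvgM; [exact: cvg_cst | have [_ _] := Ve_feasible i; apply].
apply: cvg_big => [|j _]; first exact: add_continuous.
by apply: cvgM; [exact: cvg_cst | have [_ _] := V_feasible i j; apply].
Qed.

End Valuation.

Theorem theorem3p2 (R : realType) (n : nat) (hn : (1 <= n)%N)
    (Ae Le : 'rV[R]_n) (A L : 'M[R]_n)
    (Ve : 'I_n -> 'rV[R]_n -> R) (V : 'I_n -> 'I_n -> 'rV[R]_n -> R)
    (hAe : forall i : 'I_n, 0 <= Ae ord0 i)
    (hLe : forall i : 'I_n, 0 <= Le ord0 i)
    (hA : forall i j : 'I_n, 0 <= A i j)
    (hL : forall i j : 'I_n, 0 <= L i j)
    (hAL : forall i j : 'I_n, A j i = L i j)
    (hVe : forall i : 'I_n, feasible (Ve i))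
    (hV : forall i j : 'I_n, feasible (V i j))
    (E : nat -> 'rV[R]_n)
    (hE0 : E 0%N = book_equity Ae Le A L)
    (hES : forall k : nat, E k.+1 = Phi Ae Le A L Ve V (E k)) :
  [/\ forall k : nat, lev (E k.+1) (E k),
      cvg (E @ \oo)
    & greatest_solution (Phi Ae Le A L Ve V) (lim (E @ \oo))].
Proof.
have E_noninc k : lev (E k.+1) (E k).
  elim: k => [|k IHk]; first by rewrite hES hE0; exact: Phi_le_book_equity.
  by rewrite hES [X in lev _ X]hES; exact: Phi_homo.
have Ei_noninc i : {homo (fun k => E k ord0 i) : p q / (p <= q)%N >-> q <= p}.
  by apply/nonincreasing_seqP => k; exact: E_noninc.
have Ei_cvg i : cvg ((fun k => E k ord0 i) @ \oo).
  apply: nonincreasing_is_cvgn => //.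
  exists (- Le ord0 i - \sum_(j < n) L i j) => _ [k _ <-].
  (* Passing to [E k.+1] handles [k = 0] too: [E 0] is not given as a value of [Phi], but every
     successor is. *)
  by apply: le_trans (E_noninc k i); rewrite hES; exact: Phi_ge.
have E_cvg : cvg (E @ \oo).
  apply/cvg_ex; exists (\row_i lim ((fun k => E k ord0 i) @ \oo)).
  by apply/cvg_row => i; rewrite mxE; exact: Ei_cvg.
have Elim i : (fun k => E k ord0 i) @ \oo --> lim (E @ \oo) ord0 i.
  by move: i; exact/cvg_row.
split=> //; split=> [|x x_sol i].
  apply/rowP => i; rewrite -(cvg_lim (@Rhausdorff R) (Elim i)).
  (* Dropping the first term keeps the limit and turns the sequence into the images [Phi (E k)], to
     which [Phi_cvg] applies. *)
  apply/cvg_lim => //; rewrite -cvg_shiftS/=.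
  under eq_fun do rewrite hES.
  by move: i; apply/cvg_row; exact: Phi_cvg.
have x_le k : lev x (E k).
  (* A solution is itself a value of [Phi], so both cases compare [Phi x] with the iterate. *)
  elim: k => [|k IHk]; rewrite x_sol ?hE0; first exact: Phi_le_book_equity.
  by rewrite hES; exact: Phi_homo.
rewrite -(cvg_lim (@Rhausdorff R) (Elim i)); apply: limr_ge => //.
by apply: nearW => k; exact: x_le.
Qed.
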